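(* The model $IBBE$ is an inner approximation of $SP$ in the sense that $\mathrm{Proj}_{nr}(XIBBE)\subseteq\mathrm{Proj}_{nr}(XSP)$.
   Context: $N$ is a finite set of zones, $CNE$ a finite set of critical network elements, $PTDF_{k,z}\in\mathbb{R}$ ($k\in CNE$, $z\in N$) and $\widetilde F_k\in\mathbb{R}$ ($k\in CNE$) are given parameters. $\mathrm{Proj}_{nr}$ denotes projection on the variables $nr=(nr_z)_{z\in N}\in\mathbb{R}^N$. The models $IBBE$ and $SP$ have the same objective, order-book variables and order-book constraints and differ only in that $nr$ is required to lie in $\mathrm{Proj}_{nr}(XIBBE)$, respectively $\mathrm{Proj}_{nr}(XSP)$. $XIBBE$ is the set of pairs $(nr,f)$ with $nr\in\mathbb{R}^N$ and real bilateral exchange variables $f=(f_{n,z})_{n,z\in N}$ such that $\sum_{n\in N}nr_n=0$; $nr_n=\sum_{z\ne n}(f_{n,z}-f_{z,n})$ for all $n\in N$; $\sum_{n,z\in N}\max(PTDF_{k,n}-PTDF_{k,z},0)\,f_{n,z}\le\widetilde F_k$ for all $k\in CNE$; $f_{n,z}\ge0$ for all $n,z$. $XSP$ is the set of all tuples consisting of first-stage variables $(nr_z,TRD_z,TRS_z)_{z\in N}$ and, for each scenario $s=(s_z)_{z\in N}\in\{0,1\}^{N}$, second-stage variables $(TRDAct_{z,s},TRSAct_{z,s},nrAct_{z,s})_{z\in N}$, all real, such that: $\sum_{z} nr_z=0$; $\sum_{z} PTDF_{k,z}\,nr_z\le \widetilde F_k$ for all $k\in CNE$; $nr_z=TRS_z-TRD_z$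 for all $z$; and for every $s\in\{0,1\}^N$: $TRDAct_{z,s}=s_z\,TRD_z$, $TRSAct_{z,s}\le TRS_z$, $nrAct_{z,s}=TRSAct_{z,s}-TRDAct_{z,s}$ for all $z$; $\sum_z nrAct_{z,s}=0$; $\sum_z PTDF_{k,z}\,nrAct_{z,s}\le \widetilde F_k$ for all $k\in CNE$; and $TRS,TRD,TRSAct,TRDAct\ge 0$. *)

(* Defs.v *)
From mathcomp Require Import all_boot all_order all_algebra.
From mathcomp Require Import classical_sets reals.

Set Implicit Arguments.
Unset Strict Implicit.
Unset Printing Implicit Defensive.

Import Order.TTheory GRing.Theory Num.Theory.

Local Open Scope classical_set_scope.
Local Open Scope ring_scope.

(* A point (nr, f); f n z is the bilateral exchange from zone n to zone z. *)
Record ibbe_vars (R : realType) (N : finType) := IbbeVars {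
  ibbe_nr : N -> R;
  ibbe_f : N -> N -> R
}.

Record XIBBE_constraints (R : realType) (N CNE : finType)
    (PTDF : CNE -> N -> R) (F : CNE -> R) (x : ibbe_vars R N) : Prop := {
  ibbe_balance : \sum_(n : N) ibbe_nr x n = 0;
  ibbe_net_position : forall n : N,
    ibbe_nr x n = \sum_(z : N | z != n) (ibbe_f x n z - ibbe_f x z n);
  ibbe_network : forall k : CNE,
    \sum_(n : N) \sum_(z : N)
      Num.max (PTDF k n - PTDF k z) 0 * ibbe_f x n z <= F k;
  ibbe_f_ge0 : forall n z : N, 0 <= ibbe_f x n z
}.

Definition XIBBE (R : realType) (N CNE : finType)
    (PTDF : CNE -> N -> R) (F : CNE -> R) : set (ibbe_vars R N) :=
  [set x | XIBBE_constraints PTDF F x].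

(* {0,1}^N, with true standing for 1 *)
Definition scenario (N : finType) := {ffun N -> bool}.

Record sp_vars (R : realType) (N : finType) := SpVars {
  sp_nr : N -> R;
  sp_TRD : N -> R;
  sp_TRS : N -> R;
  sp_TRDAct : N -> scenario N -> R;
  sp_TRSAct : N -> scenario N -> R;
  sp_nrAct : N -> scenario N -> R
}.

Record XSP_constraints (R : realType) (N CNE : finType)
    (PTDF : CNE -> N -> R) (F : CNE -> R) (x : sp_vars R N) : Prop := {
  sp_balance : \sum_(z : N) sp_nr x z = 0;
  sp_network : forall k : CNE, \sum_(z : N) PTDF k z * sp_nr x z <= F k;
  sp_net_position : forall z : N, sp_nr x z = sp_TRS x z - sp_TRD x z;
  sp_demand_act : forall (s : scenario N) (z : N),
    sp_TRDAct x z s = (s z)%:R * sp_TRD x z;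
  sp_supply_act : forall (s : scenario N) (z : N),
    sp_TRSAct x z s <= sp_TRS x z;
  sp_net_position_act : forall (s : scenario N) (z : N),
    sp_nrAct x z s = sp_TRSAct x z s - sp_TRDAct x z s;
  sp_balance_act : forall s : scenario N, \sum_(z : N) sp_nrAct x z s = 0;
  sp_network_act : forall (s : scenario N) (k : CNE),
    \sum_(z : N) PTDF k z * sp_nrAct x z s <= F k;
  sp_TRS_ge0 : forall z : N, 0 <= sp_TRS x z;
  sp_TRD_ge0 : forall z : N, 0 <= sp_TRD x z;
  sp_TRSAct_ge0 : forall (s : scenario N) (z : N), 0 <= sp_TRSAct x z s;
  sp_TRDAct_ge0 : forall (s : scenario N) (z : N), 0 <= sp_TRDAct x z s
}.

Definition XSP (R : realType) (N CNE : finType)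
    (PTDF : CNE -> N -> R) (F : CNE -> R) : set (sp_vars R N) :=
  [set x | XSP_constraints PTDF F x].

Definition Proj_nr_IBBE (R : realType) (N CNE : finType)
    (PTDF : CNE -> N -> R) (F : CNE -> R) : set (N -> R) :=
  @ibbe_nr R N @` XIBBE PTDF F.

Definition Proj_nr_SP (R : realType) (N CNE : finType)
    (PTDF : CNE -> N -> R) (F : CNE -> R) : set (N -> R) :=
  @sp_nr R N @` XSP PTDF F.

(* Main.v *)
Require Import Defs.
From mathcomp Require Import all_boot all_order all_algebra.
From mathcomp Require Import classical_sets reals.

(** Read the exchange [f n z] as a trade in which [n] sells and [z] buys, and
    let the total supply (demand) traded by a zone be all that it sells (buys).
    If only the buyers selected by a scenario [s] act, execute exactly the
    trades whose buyer is selected: the active exchange is [s z * f n z].  The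
    demand activated in [z] is then [s z] times its total, and the supply
    activated in [n] lies between 0 and its total.

    The net positions of any exchange sum to zero, so each scenario balances.
    A unit sent from [n] to [z] loads element [k] by [PTDF k n - PTDF k z],
    which is at most its positive part; hence the load of every exchange
    between 0 and [f] is at most the worst-case load of [f], which the
    bilateral model bounds by [F k] ([network_load_le]).  This covers all
    scenarios and the first stage, where the whole of [f] is executed. *)

Set Implicit Arguments.
Unset Strict Implicit.
Unset Printing Implicit Defensive.

Import Order.TTheory GRing.Theory Num.Theory.

Local Open Scope classical_set_scope.
Local Open Scope ring_scope.

Definition net_export (V : zmodType) (N : finType) (g : N -> N -> V) (n : N) : V :=
  \sum_z g n z - \sum_z g z n.

(** The diagonal may be included because an exchange of a zone with itself
    counts once as export and once as import. *)
Lemma net_exportE (V : zmodType) (N : finType) (g : N -> N -> V) (n : N) :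
  \sum_(z | z != n) (g n z - g z n) = net_export g n.
Proof. by rewrite /net_export -sumrB [RHS](bigD1 n) //= subrr add0r. Qed.

Lemma sum_net_export (V : zmodType) (N : finType) (g : N -> N -> V) :
  \sum_n net_export g n = 0.
Proof. by rewrite sumrB [X in _ - X]exchange_big /= subrr. Qed.

(** Summation by parts: a zonal load is a load per exchange, weighted by the
    difference of the coefficients of its two ends. *)
Lemma sum_mul_net_export (R : pzRingType) (N : finType) (p : N -> R)
    (g : N -> N -> R) :
  \sum_n p n * net_export g n = \sum_n \sum_z (p n - p z) * g n z.
Proof.
under eq_bigr do rewrite mulrBr !mulr_sumr.
rewrite sumrB [X in _ - X]exchange_big /= -sumrB.
by apply: eq_bigr => n _; rewrite -sumrB; apply: eq_bigr => z _; rewrite mulrBl.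
Qed.

(** Negative terms, which are counterflows relieving the element, are dropped
    on the right; this is what makes the bound monotone in the exchange and so
    valid for all the partial executions [g] of [f]. *)
Lemma network_load_le (R : realDomainType) (N : finType) (p : N -> R)
    (g f : N -> N -> R) :
  (forall n z, 0 <= g n z <= f n z) ->
  \sum_n p n * net_export g n
    <= \sum_n \sum_z Num.max (p n - p z) 0 * f n z.
Proof.
move=> gf; rewrite sum_mul_net_export.
apply: ler_sum => n _; apply: ler_sum => z _; have /andP[g0 gle] := gf n z.
apply: (@le_trans _ _ (Num.max (p n - p z) 0 * g n z)).
  by rewrite ler_wpM2r // le_max lexx.
by rewrite ler_wpM2l // le_max lexx orbT.
Qed.

Definition active_exchange (R : realType) (N : finType) (f : N -> N -> R)
    (s : scenario N) (n z : N) : R :=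
  (s z)%:R * f n z.

Lemma active_exchange_bounds (R : realType) (N : finType) (f : N -> N -> R)
    (s : scenario N) (n z : N) :
  0 <= f n z -> 0 <= active_exchange f s n z <= f n z.
Proof.
by rewrite /active_exchange; case: (s z) => f0; rewrite ?mul1r ?mul0r lexx f0.
Qed.

Theorem proposition3 (R : realType) (N CNE : finType)
    (PTDF : CNE -> N -> R) (F : CNE -> R) :
  Proj_nr_IBBE PTDF F `<=` Proj_nr_SP PTDF F.
Proof.
move=> _ [[nr f] [/= nr0 nrE load f0] <-] /=.
have {}nrE n : nr n = net_export f n by rewrite nrE net_exportE.
have act_bounds s n z := active_exchange_bounds s (f0 n z).
exists (SpVars nr (fun n => \sum_z f z n) (fun n => \sum_z f n z)
  (fun n s => \sum_z active_exchange f s z n)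
  (fun n s => \sum_z active_exchange f s n z)
  (fun n s => net_export (active_exchange f s) n)) => //.
split=> //=.
- move=> k; apply: le_trans (load k); under eq_bigr do rewrite nrE.
  by apply: network_load_le => n z; rewrite f0 lexx.
- by move=> s z; rewrite mulr_sumr.
- by move=> s n; apply: ler_sum => z _; case/andP: (act_bounds s n z).
- by move=> s; apply: sum_net_export.
- by move=> s k; apply: le_trans (load k); apply: network_load_le.
- by move=> z; apply: sumr_ge0.
- by move=> z; apply: sumr_ge0.
- by move=> s n; apply: sumr_ge0 => z _; case/andP: (act_bounds s n z).
- by move=> s n; apply: sumr_ge0 => z _; case/andP: (act_bounds s z n).
Qed.
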